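(* Let $p$ be a prime, $\beta\ge1$ and $\alpha_1,\dots,\alpha_n\ge1$, and put $\alpha_{\max}=\max_j\alpha_j$. Every polyfract $P\in\mathbb{Z}_{p^\beta}\binom{X_1,\dots,X_n}{\mathbb{Z}_{p^{\alpha_1}}\times\cdots\times\mathbb{Z}_{p^{\alpha_n}}}$ satisfies $$\deg(P)\le\deg\Big(\binom{0}{X_1}_{p^{\alpha_1},p^\beta}\cdots\binom{0}{X_n}_{p^{\alpha_n},p^\beta}\Big)=\sum_{j=1}^n p^{\alpha_j}-n+(\beta-1)(p-1)p^{\alpha_{\max}-1},$$ and this bound is attained (by the product of Lagrange functions shown).
   Context: $\mathbb{Z}_r=\mathbb{Z}/r\mathbb{Z}$; $\binom{X}{\delta}=X(X-1)\cdots(X-\delta+1)/\delta!$, $\binom{X}{0}=1$. A $\mathbb{Z}_{r}$-polyfract in $X_1,\dots,X_n$ is a formal finite sum $P=\sum_{\delta\in\mathbb{N}^n}P_\delta\prod_j\binom{X_j}{\delta_j}$, $P_\delta\in\mathbb{Z}_r$, evaluated at $x\in\mathbb{Z}^n$ in $\mathbb{Z}_r$ in the obvious way; its (total) degree is $\max\{\delta_1+\cdots+\delta_n:P_\delta\ne0\}$. Distinct polyfracts give distinct maps $\mathbb{Z}^n\to\mathbb{Z}_r$, so a map is identified with the polyfract representing it. $\mathbb{Z}_r\binom{X_1,\dots,X_n}{\mathbb{Z}_{q_1}\times\cdots\times\mathbb{Z}_{q_n}}$ is the set of polyfracts whose map is $q_j$-periodic in the $j$-th variable. For $q,r\ge1$,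 $\binom{0}{X}_{q,r}$ denotes the Lagrange function $\mathbb{Z}\to\mathbb{Z}_r$ taking value $1$ at $x\equiv0\pmod q$ and $0$ otherwise (it is represented by a polyfract when $q,r$ are powers of the same prime), and the product above is the function $x\mapsto\prod_j\binom{0}{x_j}_{p^{\alpha_j},p^\beta}$. *)

(* Defs.v *)
From HB Require Import structures.
From mathcomp Require Import all_boot all_order all_algebra.
Set Implicit Arguments. Unset Strict Implicit. Unset Printing Implicit Defensive.
Import Order.TTheory GRing.Theory Num.Theory.

Local Open Scope ring_scope.

(* Generalised binomial coefficient binom(x, k) = x(x-1)...(x-k+1)/k!  for x : int
   (the division is exact). *)
Definition intbinom (x : int) (k : nat) : int :=
  ((\prod_(i < k) (x - (i : nat)%:Z)) %/ (k`!)%:Z)%Z.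

(* A Z_r-polyfract in n variables: a formal finite sum
     sum_delta P_delta prod_j binom(X_j, delta_j),
   where the multi-indices delta are taken in the box {0..pf_bound}^n
   (coefficients outside the box are 0). *)
Record polyfract (n r : nat) : Type := Polyfract {
  pf_bound : nat;
  pf_coef  : {ffun 'I_n -> 'I_(pf_bound.+1)} -> 'Z_r
}.
Arguments pf_bound {n r} _.
Arguments pf_coef {n r} _ _.

Definition pf_eval (n r : nat) (P : polyfract n r) (x : 'I_n -> int) : 'Z_r :=
  \sum_(d : {ffun 'I_n -> 'I_(pf_bound P).+1})
     pf_coef P d * \prod_(j < n) (intbinom (x j) (d j))%:~R.

(* Total degree: max of |delta| over the nonzero coefficients (0 for P = 0). *)
Definition pf_deg (n r : nat) (P : polyfract n r) : nat :=
  (\max_(d : {ffun 'I_n -> 'I_(pf_bound P).+1} | pf_coef P d != 0%R)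
     \sum_(j < n) (d j : nat))%N.

Definition shift_coord (n : nat) (j : 'I_n) (q : int) (x : 'I_n -> int) : 'I_n -> int :=
  fun i => if i == j then x i + q else x i.

Definition periodic_in (n r : nat) (q : 'I_n -> nat) (f : ('I_n -> int) -> 'Z_r) : Prop :=
  forall (j : 'I_n) (x : 'I_n -> int), f (shift_coord j (q j)%:Z x) = f x.

Definition lagrange_fn (q r : nat) (x : int) : 'Z_r :=
  if (q%:Z %| x)%Z then 1 else 0.
Arguments lagrange_fn : clear implicits.
Arguments intbinom : clear implicits.

(* Main.v *)
Require Import Defs.
From HB Require Import structures.
From mathcomp Require Import all_boot all_order all_algebra.
From mathcomp Require Import zify ring.
Import Order.TTheory GRing.Theory Num.Theory.
Local Open Scope ring_scope.

(** The coefficient of [prod_j binom(X_j, d_j)] in a polyfract is the mixed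
    forward difference of its map at the origin. Expanding a periodic map along
    residue classes turns this into a combination of products of the
    one-variable numbers [u m = Delta^m g 0], with [g] of period [q = p^a].
    As [(1 + Delta)^q = 1] on such [g], the sequence satisfies
    [sum_(0 < i <= q) C(q, i) u (m + i) = 0].  Give [p] the weight
    [w = (p - 1) p^(a-1)]: since [C(q, i)] is divisible by [p^v] for some [v] with
    [i + v w >= q], the recurrence trades degree for powers of [p] without
    losing weight, so [p^k] divides [u m] once [m >= q + (k - 1) w].  This gives
    the upper bound.  Equality [i + v w = q] occurs only at [i = p^(a-1)], where
    [p^2] does not divide [C(q, i)]; hence for the Lagrange function
    [u (q - 1 + k w)] is [p^k] times a unit modulo [p^(k+1)], and the bound is
    attained. *)

(** * Iterated forward differences *)

Lemma constant_of_shift1 (T : Type) (F : int -> T) :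
  (forall x, F (x + 1) = F x) -> forall x, F x = F 0.
Proof.
move=> hF; elim/int_rect => [//|n <-|n <-].
  by rewrite -[in RHS]hF; congr F; lia.
by rewrite -[in LHS]hF; congr F; lia.
Qed.

Definition diff {V : zmodType} (F : int -> V) (x : int) : V := F (x + 1) - F x.

Notation "''Delta^' m" := (iter m diff) (at level 8, m at level 2).

Section Differences.
Variable V : zmodType.
Implicit Type F : int -> V.

Lemma iter_diff_ext m F G : F =1 G -> 'Delta^m F =1 'Delta^m G.
Proof. by move=> eFG; elim: m => [//|m IHm] x; rewrite /= /diff !IHm. Qed.

Lemma iter_diff_const0 m F : F =1 (fun=> 0) -> forall x, 'Delta^m F x = 0.
Proof. by move=> F0; elim: m => [//|m IHm] x; rewrite /= /diff !IHm subr0. Qed.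

Lemma iter_diff_shift m F c x :
  'Delta^m (fun y => F (y + c)) x = 'Delta^m F (x + c).
Proof. by elim: m x => [//|m IHm] x; rewrite /= /diff !IHm addrAC. Qed.

Lemma iter_diff_periodic m F c :
  (forall x, F (x + c) = F x) -> forall x, 'Delta^m F (x + c) = 'Delta^m F x.
Proof. by move=> hF x; rewrite -iter_diff_shift; apply: iter_diff_ext. Qed.

(** This is [(1 + Delta)^q] expanded binomially; the induction on [q] is Pascal's rule. *)
Lemma newton_shift F x q :
  F (x + q%:Z) = \sum_(i < q.+1) 'Delta^i F x *+ 'C(q, i).
Proof.
elim: q F x => [|q IHq] F x; first by rewrite big_ord1 addr0.
have -> : x + q.+1%:Z = (x + q%:Z) + 1 by lia.
have -> : F (x + q%:Z + 1) = F (x + q%:Z) + diff F (x + q%:Z).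
  by rewrite /diff [RHS]addrC subrK.
rewrite !IHq [RHS]big_ord_recl /=.
under [in RHS]eq_bigr => i _ do rewrite /= binS mulrnDr.
rewrite big_split addrA; congr (_ + _).
  rewrite big_ord_recl !bin0 [in RHS]big_ord_recr /= bin_small // mulr0n addr0.
  by [].
by apply: eq_bigr => i _; rewrite -iterSr.
Qed.

(** Periodicity says [(1 + Delta)^q = 1] on ['Delta^m F]; cancelling the term of order 0 leaves the
    recurrence. *)
Lemma periodic_iter_diff_recurrence F q :
  (forall x, F (x + q%:Z) = F x) ->
  forall m x, \sum_(i < q) 'Delta^(m + i.+1) F x *+ 'C(q, i.+1) = 0.
Proof.
move=> hF m x; have := newton_shift ('Delta^m F) x q.
rewrite iter_diff_periodic // big_ord_recl bin0 /= => /eqP.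
rewrite -[X in X == _]addr0 (inj_eq (addrI _)) eq_sym => /eqP hs.
rewrite -[RHS]hs; apply: eq_bigr => i _.
by rewrite addnC iterD.
Qed.

(** The exponent [m + i] has the parity of [m - i] and avoids truncated subtraction. *)
Definition diff_weight (m i : nat) : int := (-1) ^+ (m + i) * 'C(m, i)%:Z.

(** The weights vanish for [i > m], so the range may be padded to any [M > m]. Differences of
    different orders can then share one box of sample points. *)
Lemma iter_diffE F m M x : (m < M)%N ->
  'Delta^m F x = \sum_(i < M) F (x + i%:Z) *~ diff_weight m i.
Proof.
move=> mM; rewrite -(big_mkord xpredT (fun i => F (x + i%:Z) *~ diff_weight m i)).
rewrite (big_cat_nat _ mM) //= [X in _ + X]big1_seq ?addr0; last first.
  move=> i /andP[_]; rewrite mem_index_iota => /andP[mi _].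
  by rewrite /diff_weight bin_small // mulr0 mulr0z.
rewrite big_mkord {M mM}.
elim: m x => [|m IHm] x; first by rewrite big_ord1 addr0.
have wS i : diff_weight m.+1 i.+1 = diff_weight m i - diff_weight m i.+1.
  by rewrite /diff_weight binS addSn addnS !exprS PoszD; ring.
have w0 : diff_weight m.+1 0 = - diff_weight m 0.
  by rewrite /diff_weight !bin0 addSn exprS; ring.
rewrite /= /diff !IHm [in RHS]big_ord_recl /= w0 mulrNz.
under [in RHS]eq_bigr => i _ do rewrite /bump /= add1n wS mulrzBr.
rewrite big_split /= sumrN [X in _ - X]big_ord_recl /=.
rewrite [X in _ = _ + (_ - X)]big_ord_recr /=.
rewrite [in X in _ = _ + (_ - (_ + X))]/diff_weight bin_small // mulr0 mulr0z.
rewrite [X in _ = _ + (_ - X)]addr0 [in LHS]opprD [LHS]addrCA; congr (_ + (_ - _)).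
by apply: eq_bigr => i _; congr (F _ *~ _); lia.
Qed.

End Differences.

Lemma iter_diff_raddf (U V : zmodType) (h : {additive U -> V}) m (F : int -> U) x :
  'Delta^m (fun y => h (F y)) x = h ('Delta^m F x).
Proof. by elim: m x => [//|m IHm] x; rewrite /= /diff !IHm raddfB. Qed.

(** * Integer-valued binomials and Newton expansion *)

Lemma falling_diff (k : nat) (x : int) :
  \prod_(i < k.+1) (x + 1 - (i : nat)%:Z) =
  \prod_(i < k.+1) (x - (i : nat)%:Z) + k.+1%:Z * \prod_(i < k) (x - (i : nat)%:Z).
Proof.
rewrite big_ord_recl [in RHS]big_ord_recr /= subr0.
under eq_bigr => i _ do rewrite /bump /= add1n intS opprD addrA addrK.
by rewrite intS; ring.
Qed.

Lemma dvdz_fact_falling (k : nat) (x : int) :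
  (k`!%:Z %| \prod_(i < k) (x - (i : nat)%:Z))%Z.
Proof.
elim: k x => [|k IHk] x; first by rewrite fact0 dvd1z.
suff -> : (k.+1`!%:Z %| \prod_(i < k.+1) (x - (i : nat)%:Z))%Z =
          (k.+1`!%:Z %| \prod_(i < k.+1) (0 - (i : nat)%:Z))%Z.
  by rewrite big_ord_recl subrr mul0r dvdz0.
apply: (@constant_of_shift1 _
  (fun x => (k.+1`!%:Z %| \prod_(i < k.+1) (x - (i : nat)%:Z))%Z)) => y.
rewrite falling_diff; apply: rpredDr.
by rewrite factS PoszM dvdz_mul.
Qed.

Lemma intbinomK (x : int) (k : nat) :
  intbinom x k * k`!%:Z = \prod_(i < k) (x - (i : nat)%:Z).
Proof. by rewrite /intbinom divzK // dvdz_fact_falling. Qed.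

Lemma intbinom_n0 (x : int) : intbinom x 0 = 1.
Proof. by rewrite /intbinom big_ord0 fact0. Qed.

Lemma intbinom_0S (k : nat) : intbinom 0 k.+1 = 0.
Proof. by rewrite /intbinom big_ord_recl subrr mul0r div0z. Qed.

Lemma diff_intbinomS (k : nat) (x : int) :
  diff (fun y => intbinom y k.+1) x = intbinom x k.
Proof.
have nz : (k.+1`!)%:Z != 0 by rewrite eqz_nat -lt0n fact_gt0.
apply: (mulIf nz).
rewrite /diff mulrBl !intbinomK falling_diff addrC addKr.
by rewrite factS PoszM mulrCA intbinomK.
Qed.

Lemma iter_diff_intbinom0 (m d : nat) :
  'Delta^m (fun y => intbinom y d) 0 = (m == d)%:Z.
Proof.
elim: d m => [|d IHd] [|m].
- by rewrite /= intbinom_n0.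
- rewrite iterSr; apply: iter_diff_const0 => x.
  by rewrite /diff !intbinom_n0 subrr.
- by rewrite /= intbinom_0S.
- by rewrite iterSr (iter_diff_ext _ _ _ _ (diff_intbinomS d)) IHd eqSS.
Qed.

(** The induction hypothesis for [diff F] shows that the remainder [G] has zero difference, hence is
    constant; it vanishes at 0. *)
Lemma newton_expansion (V : zmodType) (B : nat) (F : int -> V) :
  (forall x, 'Delta^B F x = 0) ->
  forall x, F x = \sum_(d < B) 'Delta^d F 0 *~ intbinom x d.
Proof.
elim: B F => [|B IHB] F hF x; first by rewrite big_ord0; exact: hF.
pose G y := F y - \sum_(d < B.+1) 'Delta^d F 0 *~ intbinom y d.
suff : G x = G 0.
  rewrite /G [in RHS]big_ord_recl intbinom_n0 /= mulr1z.
  rewrite [X in _ = _ - (_ + X)]big1 => [|i _]; last by rewrite intbinom_0S.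
  by rewrite addr0 subrr => /eqP; rewrite subr_eq0 => /eqP.
apply: constant_of_shift1 => y; apply: subr0_eq.
rewrite /G opprD addrACA -opprD -/(diff F y).
rewrite (IHB (diff F)); last by move=> z; rewrite -iterSr.
apply/eqP; rewrite subr_eq0 -sumrB big_ord_recl !intbinom_n0 subrr add0r.
apply/eqP; apply: eq_bigr => i _.
by rewrite -iterSr -mulrzBr -diff_intbinomS.
Qed.

(** * Divisibility of differences of periodic sequences *)

(** Take [v = a - l] with [l] the [p]-adic valuation of [i]; divisibility follows from
    [i C(q, i) = q C(q - 1, i - 1)]. If [l = a - 1], then [v = 1] and [i] is a multiple of
    [p^(a-1) = q - w]; otherwise [v >= 2] and [2 w >= q]. The boolean summand records that equality
    forces [i = p^(a-1)]. *)
Lemma bin_prime_power_weight (p a i : nat) :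
  prime p -> (0 < i < p ^ a)%N ->
  exists v, [/\ (0 < v)%N, (p ^ v %| 'C(p ^ a, i))%N &
    (p ^ a + (i != p ^ a.-1) <= i + v * ((p - 1) * p ^ a.-1))%N].
Proof.
move=> pr /andP[i0 iq]; have p1 := prime_gt1 pr.
case: a iq => [|a] iq; first by rewrite expn0 in iq; lia.
have [c cc ei] := pfactor_coprime pr i0; set l := logn p i in ei.
have c0 : (0 < c)%N by lia.
have pli : (p ^ l <= i)%N by rewrite ei; apply: leq_pmull.
have la : (l <= a)%N.
  by rewrite -ltnS -(ltn_exp2l _ _ p1); apply: leq_ltn_trans iq.
exists (a.+1 - l)%N; split; first by lia.
  have cpv : coprime (p ^ (a.+1 - l)) c by rewrite coprimeXl.
  rewrite -(Gauss_dvdr _ cpv).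
  have l0 : (0 < p ^ l)%N by rewrite expn_gt0; lia.
  rewrite -(dvdn_pmul2l l0) -expnD subnKC; last by lia.
  rewrite mulnA [(_ * c)%N]mulnC -ei.
  have := mul_bin_diag (p ^ a.+1) i.-1; rewrite (prednK i0) => <-.
  exact: dvdn_mulr.
have P0 : (0 < p ^ a)%N by rewrite expn_gt0; lia.
rewrite /= expnS.
have [ela|nla] := eqVneq l a.
  rewrite ela subSnn mul1n; rewrite ela in pli.
  case: eqVneq => ? /=; nia.
have : (2 <= a.+1 - l)%N by lia.
move: (a.+1 - l)%N (p ^ a)%N P0 => v P P0 v2.
have : (2 * ((p - 1) * P) <= v * ((p - 1) * P))%N by rewrite leq_mul2r v2 orbT.
by case: (_ != _) => /=; nia.
Qed.

Section PrimePowerRecurrence.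
Variables (p a : nat) (u : nat -> int).
Hypotheses (p_pr : prime p) (a_gt0 : (0 < a)%N).
Let q := (p ^ a)%N.
Let w := ((p - 1) * p ^ a.-1)%N.
Hypothesis u_rec : forall m, \sum_(i < q) u (m + i.+1)%N *+ 'C(q, i.+1) = 0.

Let q_gt0 : (0 < q)%N. Proof. by rewrite expn_gt0 prime_gt0. Qed.

Let u_step m : u (m + q)%N = - \sum_(i < q.-1) u (m + i.+1)%N *+ 'C(q, i.+1).
Proof.
apply/eqP; rewrite -addr_eq0 addrC; apply/eqP; rewrite -[RHS](u_rec m).
by rewrite -(prednK q_gt0) big_ord_recr /= binn.
Qed.

(** In each term of [u_step] the binomial supplies [p^v] and the induction hypothesis at [k - v]
    supplies the rest; [v > 0] makes the induction on [k] alone work. *)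
Lemma recurrence_dvd k m : (q + k * w <= m + w)%N -> ((p ^ k)%N%:Z %| u m)%Z.
Proof.
elim/ltn_ind: k m => -[|k] IHk m hm; first by rewrite expn0 dvd1z.
have hkm : (q + k * w <= m)%N by lia.
rewrite -(subnK (leq_trans (leq_addr _ _) hkm)) u_step rpredN.
apply: rpred_sum => i _.
have iq : (0 < i.+1 < q)%N by have := ltn_ord i; lia.
have [v [v0 pv wv]] := bin_prime_power_weight p a i.+1 p_pr iq.
rewrite -mulr_natl natz.
(* The truncated difference is harmless: if [v > k.+1], the first factor already suffices. *)
apply: (@dvdz_trans (p ^ v * p ^ (k.+1 - v))%N).
  by rewrite -expnD dvdzE /= dvdn_exp2l //; lia.
rewrite PoszM; apply: dvdz_mul; first by rewrite dvdzE.
case: (leqP v k.+1) => vk; last first.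
  by rewrite (_ : (k.+1 - v = 0)%N) ?expn0 ?dvd1z //; lia.
apply: IHk; first by lia.
rewrite -/q -/w in wv; rewrite mulnBl mulSn.
have : (v * w <= w + k * w)%N by rewrite -mulSn leq_mul2r vk orbT.
by lia.
Qed.

(** Each step from [k] to [k + 1] multiplies the leading part by [- C(q, p^(a-1))]: all other terms
    of the recurrence carry one more factor [p]. *)
Lemma recurrence_leading k :
  ((p ^ k.+1)%N%:Z %|
   u (q.-1 + k * w)%N - (- ('C(q, p ^ a.-1))%:Z) ^+ k * u q.-1)%Z.
Proof.
have p1 := prime_gt1 p_pr.
have P0 : (0 < p ^ a.-1)%N by rewrite expn_gt0; lia.
have eq : q = (w + p ^ a.-1)%N.
  rewrite /w /q -{1}(prednK a_gt0) expnS mulnBl mul1n subnK //.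
  by apply: leq_pmull; lia.
have w0 : (0 < w)%N by rewrite /w muln_gt0; lia.
elim: k => [|k IHk]; first by rewrite mul0n addn0 expr0 mul1r subrr dvdz0.
have -> : (q.-1 + k.+1 * w = (k * w + w.-1) + q)%N by rewrite mulSn; lia.
have i0P : ((p ^ a.-1).-1 < q.-1)%N by lia.
rewrite u_step (bigD1 (Ordinal i0P)) //= (prednK P0).
have -> : (k * w + w.-1 + p ^ a.-1 = q.-1 + k * w)%N by lia.
rewrite opprD addrAC; apply: rpredB; last first.
  apply: rpred_sum => i; rewrite -val_eqE /= => ni.
  have iq : (0 < i.+1 < q)%N by have := ltn_ord i; lia.
  have [v [v0 pv wv]] := bin_prime_power_weight p a i.+1 p_pr iq.
  rewrite -mulr_natl natz.
  apply: (@dvdz_trans (p ^ v * p ^ (k.+2 - v))%N).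
    by rewrite -expnD dvdzE /= dvdn_exp2l //; lia.
  rewrite PoszM; apply: dvdz_mul; first by rewrite dvdzE.
  case: (leqP v k.+2) => vk; last first.
    by rewrite (_ : (k.+2 - v = 0)%N) ?expn0 ?dvd1z //; lia.
  apply: recurrence_dvd.
  rewrite -/q -/w in wv; rewrite mulnBl !mulSn.
  have : (v * w <= w + (w + k * w))%N by rewrite -!mulSn leq_mul2r vk orbT.
  (* The inequality is strict here, and the unit gained pays for the [w.-1] in the index. *)
  have : (i.+1 != p ^ a.-1)%N by lia.
  move=> h; rewrite h /= in wv; lia.
(* The remaining term is the previous error times [C(q, p^(a-1))], which contributes the additional
   factor [p]. *)
rewrite -mulr_natl natz exprS -mulrA -mulNr -mulrBr expnS PoszM.
apply: dvdz_mul => //; rewrite rpredN dvdzE /=.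
have aq : (0 < p ^ a.-1 < p ^ a)%N by rewrite P0 ltn_exp2l //; lia.
have [[|v] [// _ pv _]] := bin_prime_power_weight p a _ p_pr aq.
by apply: dvdn_trans pv; rewrite expnS dvdn_mulr.
Qed.

(** As [p] divides [C(q, i + 1) = C(q - 1, i + 1) + C(q - 1, i)] for [0 < i + 1 < q],
    non-divisibility propagates from [C(q - 1, 0) = 1]. *)
Lemma prime_ndvd_bin_pred i : (i < q)%N -> ~~ (p %| 'C(q.-1, i))%N.
Proof.
elim: i => [|i IHi] iq; first by rewrite bin0 dvdn1; have := prime_gt1 p_pr; lia.
apply/negP => h; move: (IHi (ltnW iq)); rewrite -(dvdn_addr _ h) -binS prednK //.
have [[|v] [// _ pv _]] := bin_prime_power_weight p a i.+1 p_pr iq.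
by rewrite (dvdn_trans _ pv) // expnS dvdn_mulr.
Qed.

(** The leading part has valuation exactly [k], because [C(q, p^(a-1))] is [p] times
    [C(q - 1, p^(a-1) - 1)], which is prime to [p]. *)
Lemma recurrence_ndvd k :
  `|u q.-1|%N = 1%N -> ~~ ((p ^ k.+1)%N%:Z %| u (q.-1 + k * w)%N)%Z.
Proof.
move=> u1; have p1 := prime_gt1 p_pr.
have P0 : (0 < p ^ a.-1)%N by rewrite expn_gt0; lia.
rewrite -(subrK ((- ('C(q, p ^ a.-1))%:Z) ^+ k * u q.-1) (u _)).
rewrite rpredDl ?recurrence_leading // dvdzE abszM u1 muln1 abszX abszN /=.
have -> : ('C(q, p ^ a.-1) = p * 'C(q.-1, (p ^ a.-1).-1))%N.
  apply/eqP; rewrite -(eqn_pmul2l P0).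
  have := mul_bin_diag q (p ^ a.-1).-1; rewrite (prednK P0) => <-.
  by rewrite mulnA -expnSr (prednK a_gt0).
rewrite expnMn expnSr dvdn_pmul2l ?expn_gt0; last by lia.
rewrite (Euclid_dvdX _ _ p_pr); apply/negP => /andP[h _].
suff : ((p ^ a.-1).-1 < q)%N by move=> /prime_ndvd_bin_pred; rewrite h.
by rewrite prednK // leq_exp2l //; lia.
Qed.

End PrimePowerRecurrence.

(** The bound on [r] is due to the convention that ['Z_0] and ['Z_1] are the ring with two
    elements. *)
Lemma intr_Zp_eq0 (r : nat) (z : int) :
  (1 < r)%N -> ((z%:~R : 'Z_r) == 0) = (r%:Z %| z)%Z.
Proof.
move=> r1.
have natE k : ((k%:R : 'Z_r) == 0) = (r %| k)%N.
  by rewrite -val_eqE /= val_Zp_nat.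
by case: z => k; rewrite ?NegzE ?mulrNz ?oppr_eq0 ?rpredN -pmulrn natE dvdzE.
Qed.

(** Integer-valued, so that powers of [p] in its differences can be measured before reduction modulo
    [p^beta]. *)
Definition residue_ind (q s : nat) (x : int) : int := ((x %% q%:Z)%Z == s%:Z)%:Z.

Lemma residue_ind_periodic q s x : residue_ind q s (x + q%:Z) = residue_ind q s x.
Proof. by rewrite /residue_ind modzDr. Qed.

Lemma lagrange_fnE q r x : lagrange_fn q r x = (residue_ind q 0 x)%:~R.
Proof.
rewrite /lagrange_fn /residue_ind.
by case: dvdz_mod0P => [->|/eqP/negPf ->].
Qed.

Section PeriodicDifferences.
Variables (p a : nat) (g : int -> int).
Hypotheses (p_pr : prime p) (a_gt0 : (0 < a)%N).
Hypothesis g_per : forall x, g (x + (p ^ a)%N%:Z) = g x.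

Lemma periodic_iter_diff_dvd k m x :
  (p ^ a + k * ((p - 1) * p ^ a.-1) <= m + (p - 1) * p ^ a.-1)%N ->
  ((p ^ k)%N%:Z %| 'Delta^m g x)%Z.
Proof.
apply: (@recurrence_dvd p a (fun m => 'Delta^m g x)) => // l.
exact: periodic_iter_diff_recurrence.
Qed.

Lemma periodic_iter_diff_dvd_ex m x :
  exists k, ((p ^ k)%N%:Z %| 'Delta^m g x)%Z /\
    (m < p ^ a + k * ((p - 1) * p ^ a.-1))%N.
Proof.
have p1 := prime_gt1 p_pr.
set w := ((p - 1) * p ^ a.-1)%N.
have w0 : (0 < w)%N by rewrite muln_gt0 expn_gt0; lia.
(* The largest [k] allowed by [periodic_iter_diff_dvd], or 0 when [m + w < p ^ a]. *)
exists ((m + w - p ^ a) %/ w)%N; split.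
  have [h|h] := leqP (p ^ a) (m + w).
    apply: periodic_iter_diff_dvd; rewrite -/w.
    by have := leq_divM (m + w - p ^ a) w; lia.
  by rewrite (_ : (m + w - p ^ a = 0)%N) ?div0n ?dvd1z //; lia.
have := ltn_ceil (m + w - p ^ a) w0; rewrite mulSn; lia.
Qed.

End PeriodicDifferences.

(** Among the nodes [0, ..., m] only 0 is a multiple of [q], and its weight is a sign. *)
Lemma iter_diff_residue_ind0 q m : (m < q)%N ->
  `|'Delta^m (residue_ind q 0) 0|%N = 1%N.
Proof.
move=> mq; rewrite (iter_diffE _ _ _ _ _ (ltnSn m)) big_ord_recl big1 => [|i _].
  rewrite addr0 /residue_ind mod0z eqxx mulrzz mul1r /diff_weight bin0 mulr1.
  by rewrite abszX abszN1 exp1n.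
rewrite /residue_ind add0r modz_small ?mul0rz //.
by rewrite /= /bump; have := ltn_ord i; lia.
Qed.

Lemma residue_ind_leading_ndvd p a k : prime p -> (0 < a)%N ->
  ~~ ((p ^ k.+1)%N%:Z %|
      'Delta^((p ^ a).-1 + k * ((p - 1) * p ^ a.-1)) (residue_ind (p ^ a) 0) 0)%Z.
Proof.
move=> p_pr a_gt0.
apply: (@recurrence_ndvd p a (fun m => 'Delta^m (residue_ind (p ^ a) 0) 0)) => //.
  move=> m; apply: periodic_iter_diff_recurrence; exact: residue_ind_periodic.
by apply: iter_diff_residue_ind0; rewrite prednK // expn_gt0 prime_gt0.
Qed.

(** * Coefficients of polyfracts *)

Section MixedDifferences.
Variables n r : nat.
Implicit Types (f : ('I_n -> int) -> 'Z_r) (P : polyfract n r).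

(** The operator [prod_j Delta_j^(dl j)] at the origin, written as one weighted sum over a box
    rather than as a composition. *)
Definition mixed_diff (M : nat) (dl : 'I_n -> nat) f : 'Z_r :=
  \sum_(i : {ffun 'I_n -> 'I_M})
     (\prod_(j < n) (diff_weight (dl j) (i j))%:~R) * f (fun j => (i j : nat)%:Z).

Lemma mixed_diff_prod M dl c (g : 'I_n -> int -> int) :
  (forall j, dl j < M)%N ->
  mixed_diff M dl (fun x => c * \prod_(j < n) (g j (x j))%:~R) =
  c * \prod_(j < n) ('Delta^(dl j) (g j) 0)%:~R.
Proof.
move=> dlM.
under [in RHS]eq_bigr => j _.
  rewrite (iter_diffE _ _ _ _ _ (dlM j)) rmorph_sum /=.
  under eq_bigr => i _ do rewrite mulrzz add0r mulrC rmorphM /=.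
  over.
rewrite bigA_distr_bigA mulr_sumr; apply: eq_bigr => i _.
by rewrite big_split /= mulrCA.
Qed.

(** Differences at 0 are dual to the binomial basis. The right side is a sum because [dl] may lie
    outside the box of [P]; it is then empty. *)
Lemma mixed_diff_pf_eval M dl P : (forall j, dl j < M)%N ->
  mixed_diff M dl (pf_eval P) =
  \sum_(d : {ffun 'I_n -> 'I_(pf_bound P).+1} | [forall j, d j == dl j :> nat]) pf_coef P d.
Proof.
move=> dlM; rewrite /mixed_diff /pf_eval.
under eq_bigr => i _ do rewrite mulr_sumr.
rewrite exchange_big /= [RHS]big_mkcond; apply: eq_bigr => d _.
rewrite -/(mixed_diff M dl (fun x => pf_coef P d *
   \prod_(j < n) (intbinom (x j) (d j))%:~R)).
rewrite (mixed_diff_prod _ _ _ (fun j x => intbinom x (d j))) //.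
under eq_bigr => j _ do rewrite iter_diff_intbinom0.
case: ifPn => [/forallP dE|].
  by rewrite big1 ?mulr1 // => j _; rewrite (eqP (dE j)) eqxx.
rewrite negb_forall => /existsP[j nj].
by rewrite (bigD1 j) //= eq_sym (negPf nj) mul0r mulr0.
Qed.

Lemma mixed_diff_coef P (d : {ffun 'I_n -> 'I_(pf_bound P).+1}) :
  mixed_diff (pf_bound P).+1 (fun j => d j) (pf_eval P) = pf_coef P d.
Proof.
rewrite mixed_diff_pf_eval => [|j]; last exact: ltn_ord.
rewrite (big_pred1 d) // => d' /=; apply/forallP/eqP => [h|-> j //].
by apply/ffunP => j; apply/val_inj/eqP/h.
Qed.

Lemma eq_pf_eval P x y : x =1 y -> pf_eval P x = pf_eval P y.
Proof.
move=> exy; apply: eq_bigr => d _; congr (_ * _).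
by apply: eq_bigr => j _; rewrite exy.
Qed.

(** Induction on the total number of shifts, removing one shift in one coordinate at a time. *)
Lemma periodic_in_multiples (q : 'I_n -> nat) f :
  (forall x y, x =1 y -> f x = f y) -> periodic_in q f ->
  forall (k : 'I_n -> nat) x, f (fun j => x j + (k j * q j)%N%:Z) = f x.
Proof.
move=> f_ext f_per k x; move eqN : (\sum_(j < n) k j)%N => N.
elim: N k eqN => [|N IHN] k eqN.
  apply: f_ext => j; move/eqP: eqN; rewrite sum_nat_eq0 => /forallP /(_ j) /eqP ->.
  by rewrite mul0n addr0.
have [j kj] : exists j, (0 < k j)%N.
  apply/existsP; apply: contra_eqT eqN; rewrite negb_exists => /forallP k0.
  by rewrite big1 // => j _; apply/eqP; rewrite -leqn0 leqNgt k0.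
pose k' i := if i == j then (k i).-1 else k i.
rewrite -(IHN k'); last first.
  move: eqN; rewrite (bigD1 j) //= [in X in _ -> X](bigD1 j) //= /k' eqxx.
  rewrite [in X in _ -> X](eq_bigr k); last by move=> i /negPf ->.
  by lia.
rewrite -[RHS](f_per j); apply: f_ext => i; rewrite /shift_coord /k'.
case: eqP => [->|_ //].
by rewrite -addrA -PoszD -[in LHS](prednK kj) mulSn addnC.
Qed.

Lemma periodic_in_residues (q : 'I_n -> nat) f M (i : {ffun 'I_n -> 'I_M}) :
  (forall x y, x =1 y -> f x = f y) -> periodic_in q f ->
  f (fun j => (i j : nat)%:Z) =
  \sum_(s : {ffun 'I_n -> 'I_M}) f (fun j => (s j : nat)%:Z) *
     \prod_(j < n) (residue_ind (q j) (s j) (i j : nat)%:Z)%:~R.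
Proof.
move=> f_ext f_per.
(* The only contributing index: the vector of remainders, which stays in the box since
   [i %% q <= i]. *)
pose s0 : {ffun 'I_n -> 'I_M} := [ffun j =>
  Ordinal (leq_ltn_trans (leq_mod (i j) (q j)) (ltn_ord (i j)))].
rewrite (bigD1 s0) //= [X in _ + X]big1 ?addr0 => [|s ns]; last first.
  have [j nj] : exists j, s j != s0 j.
    apply/existsP; rewrite -negb_forall; apply: contra ns => /forallP h.
    by apply/eqP/ffunP => j; apply/eqP.
  rewrite (bigD1 j) //= /residue_ind modz_nat eqz_nat.
  have -> : ((i j %% q j)%N == s j) = false.
    by apply/negbTE; rewrite eq_sym; move: nj; rewrite ffunE.
  by rewrite mul0r mulr0.
rewrite big1 ?mulr1 => [|j _]; last first.
  by rewrite /residue_ind ffunE modz_nat eqxx.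
rewrite -[RHS](periodic_in_multiples q f f_ext f_per (fun j => i j %/ q j)%N).
by apply: f_ext => j; rewrite ffunE /= -PoszD addnC -divn_eq.
Qed.

Lemma mixed_diff_periodic (q : 'I_n -> nat) f M dl :
  (forall x y, x =1 y -> f x = f y) -> periodic_in q f ->
  (forall j, dl j < M)%N ->
  mixed_diff M dl f =
  \sum_(s : {ffun 'I_n -> 'I_M}) f (fun j => (s j : nat)%:Z) *
     \prod_(j < n) ('Delta^(dl j) (residue_ind (q j) (s j)) 0)%:~R.
Proof.
move=> f_ext f_per dlM; rewrite /mixed_diff.
under eq_bigr => i _ do rewrite (periodic_in_residues q) // mulr_sumr.
rewrite exchange_big /=; apply: eq_bigr => s _.
by rewrite -(mixed_diff_prod M _ _ (fun j => residue_ind (q j) (s j))).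
Qed.

End MixedDifferences.

(** * The degree bound and the product of Lagrange functions *)

Lemma lagrange_newton p a beta B x : prime p -> (0 < a)%N -> (0 < beta)%N ->
  (p ^ a + beta * ((p - 1) * p ^ a.-1) <= B)%N ->
  lagrange_fn (p ^ a) (p ^ beta) x =
  \sum_(d < B) ('Delta^d (residue_ind (p ^ a) 0) 0)%:~R * (intbinom x d)%:~R.
Proof.
move=> p_pr a_gt0 beta_gt0 hB.
have r1 : (1 < p ^ beta)%N by rewrite -(exp1n beta) ltn_exp2r // prime_gt1.
pose F (y : int) : 'Z_(p ^ beta) := (residue_ind (p ^ a) 0 y)%:~R.
have FE m y : 'Delta^m F y = ('Delta^m (residue_ind (p ^ a) 0) y)%:~R.
  exact: (@iter_diff_raddf _ _ (intmul 1)).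
rewrite lagrange_fnE -/(F x) (newton_expansion _ B) => [|y].
  by apply: eq_bigr => d _; rewrite FE mulrzr.
(* At order [B] the integer difference is divisible by [p ^ beta]. *)
apply/eqP; rewrite FE intr_Zp_eq0 //.
apply: (periodic_iter_diff_dvd p a) => //; first exact: residue_ind_periodic.
exact: leq_trans hB (leq_addr _ _).
Qed.

Section PeriodicPolyfracts.
Variables (p beta n : nat) (alpha : 'I_n -> nat).
Hypotheses (p_pr : prime p) (beta_gt0 : (0 < beta)%N).
Hypothesis alpha_gt0 : forall j, (0 < alpha j)%N.
Let r := (p ^ beta)%N.
Let q j := (p ^ alpha j)%N.
Let w := ((p - 1) * p ^ (\max_(j < n) alpha j).-1)%N.
Let D := (\sum_(j < n) (q j).-1 + beta.-1 * w)%N.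
Let L (x : 'I_n -> int) : 'Z_r := \prod_(j < n) lagrange_fn (q j) r (x j).

Let p_gt1 : (1 < p)%N. Proof. exact: prime_gt1. Qed.
Let r_gt1 : (1 < r)%N.
Proof. by rewrite -(exp1n beta) ltn_exp2r. Qed.
Let q_gt0 j : (0 < q j)%N.
Proof. by rewrite expn_gt0 prime_gt0. Qed.

(** If [|d| > D], every product of one-variable differences is divisible by [p] to the power
    [sum_j k j]. Summing [d j + 1 <= q j + k j * w] shows that this exponent is at least [beta], so
    the coefficient vanishes. *)
Lemma pf_deg_periodic_le (P : polyfract n r) :
  periodic_in q (pf_eval P) -> (pf_deg P <= D)%N.
Proof.
move=> P_per; apply/bigmax_leqP => d; apply: contraNT; rewrite -ltnNge => hD.
rewrite -mixed_diff_coef (mixed_diff_periodic _ _ q) //; last first.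
  exact: eq_pf_eval.
rewrite big1 // => s _.
have /fin_all_exists[k hk] j :=
  periodic_iter_diff_dvd_ex p (alpha j) (residue_ind (q j) (s j)) p_pr (alpha_gt0 j)
    (residue_ind_periodic _ _) (d j) 0.
have -> : \prod_(j < n) ('Delta^(d j) (residue_ind (q j) (s j)) 0)%:~R = 0 :> 'Z_r.
  rewrite -rmorph_prod; apply/eqP; rewrite intr_Zp_eq0 //.
  apply: (@dvdz_trans (p ^ \sum_(j < n) k j)%N).
    rewrite dvdzE dvdn_exp2l // leqNgt; apply/negP => hk'.
    have : (\sum_(j < n) (d j).+1 <= \sum_(j < n) (q j + k j * w))%N.
      apply: leq_sum => j _; have [_ /leq_trans -> //] := hk j.
      (* The weight of each coordinate is at most [w], the weight for the maximal [alpha]. *)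
      rewrite leq_add2l leq_mul2l leq_mul2l leq_exp2l //.
      have : (alpha j <= \max_(i < n) alpha i)%N by exact: leq_bigmax.
      by move=> amax; rewrite (_ : (_.-1 <= _)%N) ?orbT //; lia.
    have -> : (\sum_(j < n) (d j).+1 = \sum_(j < n) d j + n)%N.
      under eq_bigr => j _ do rewrite -addn1.
      by rewrite big_split /= sum1_card card_ord.
    have -> : (\sum_(j < n) (q j + k j * w) =
        \sum_(j < n) (q j).-1 + n + (\sum_(j < n) k j) * w)%N.
      rewrite big_split /= big_distrl; congr (_ + _)%N.
      under eq_bigr => j _ do rewrite -(prednK (q_gt0 j)) -addn1.
      by rewrite big_split /= sum1_card card_ord.
    have : ((\sum_(j < n) k j) * w <= beta.-1 * w)%N by rewrite leq_mul2r; lia.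
    move: hD; rewrite /D.
    move: (beta.-1 * w)%N ((\sum_(j < n) k j) * w)%N => b c.
    by move: (\sum_(j < n) d j)%N (\sum_(j < n) (q j).-1)%N => e f; lia.
  rewrite expn_sum (big_morph Posz PoszM (erefl _)).
  apply: (big_ind2 (fun x y => (x %| y)%Z)) => // [x1 y1 x2 y2|j _].
    exact: dvdz_mul.
  by have [] := hk j.
by rewrite mulr0.
Qed.

Lemma lagrange_polyfract_ex : exists Q : polyfract n r, forall x, pf_eval Q x = L x.
Proof.
pose B := (\sum_(j < n) (q j + beta * ((p - 1) * p ^ (alpha j).-1)))%N.
exists (@Polyfract n r B (fun d =>
  \prod_(j < n) ('Delta^(d j) (residue_ind (q j) 0) 0)%:~R)) => x.
rewrite /pf_eval /=; under eq_bigr => d _ do rewrite -big_split /=.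
rewrite -(bigA_distr_bigA (fun j (e : 'I_B.+1) =>
  ('Delta^e (residue_ind (q j) 0) 0)%:~R * (intbinom (x j) e)%:~R)) /=.
apply: eq_bigr => j _; rewrite -lagrange_newton // -/(q j).
by rewrite /B (bigD1 j) //= -addnS leq_addr.
Qed.

Lemma periodic_lagrange_prod : periodic_in q L.
Proof.
move=> j x; apply: eq_bigr => i _; rewrite /shift_coord.
by case: eqP => [->|//]; rewrite !lagrange_fnE residue_ind_periodic.
Qed.

Lemma pf_deg_lagrange_ge (Q : polyfract n r) : (0 < n)%N ->
  (forall x, pf_eval Q x = L x) -> (D <= pf_deg Q)%N.
Proof.
move=> n_gt0 QL.
have [|j0 j0max] := bigop.eq_bigmax alpha; first by rewrite card_ord.
(* All the excess degree goes to a coordinate with maximal [alpha]; every other factor has order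
   [(q j).-1] and equals a sign. *)
pose dl j := ((q j).-1 + (j == j0) * (beta.-1 * w))%N.
have dlD : (\sum_(j < n) dl j = D)%N.
  rewrite big_split /=; congr addn; rewrite (bigD1 j0) //= eqxx mul1n big1 ?addn0 //.
  by move=> j /negPf ->.
have dlM j : (dl j < D.+1)%N by rewrite ltnS -dlD (bigD1 j) //= leq_addr.
have : mixed_diff n r D.+1 dl (pf_eval Q) != 0.
  have -> : mixed_diff n r D.+1 dl (pf_eval Q) =
    mixed_diff n r D.+1 dl (fun x => 1 * \prod_(j < n) (residue_ind (q j) 0 (x j))%:~R).
    apply: eq_bigr => i _; rewrite QL mul1r; congr (_ * _).
    by apply: eq_bigr => j _; rewrite lagrange_fnE.
  rewrite (mixed_diff_prod _ _ _ _ _ (fun j => residue_ind (q j) 0)) // mul1r.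
  rewrite -rmorph_prod intr_Zp_eq0 // (bigD1 j0) //= dvdzE abszM.
  rewrite (_ : `|(\prod_(i < n | i != j0) _)%R|%N = 1%N).
    rewrite muln1 -dvdzE /dl eqxx mul1n /w j0max /r.
    have := residue_ind_leading_ndvd p (alpha j0) beta.-1 p_pr (alpha_gt0 j0).
    by rewrite prednK.
  elim/big_ind: _ => // [x y|j /negPf nj]; first by rewrite abszM => -> ->.
  by rewrite /dl nj mul0n addn0 iter_diff_residue_ind0 // prednK.
rewrite mixed_diff_pf_eval // => nz.
have [d /andP[/forallP dE dnz]] : exists d : {ffun 'I_n -> 'I_(pf_bound Q).+1},
    [forall j, d j == dl j :> nat] && (pf_coef Q d != 0).
  apply/existsP; apply: contraNT nz; rewrite negb_exists => /forallP h.
  by rewrite big1 // => d dE; apply/eqP; move: (h d); rewrite dE negbK.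
rewrite -dlD (eq_bigr (fun j => d j : nat)) => [|j _]; last by rewrite (eqP (dE j)).
exact: (leq_bigmax_cond d).
Qed.

End PeriodicPolyfracts.

Theorem theorem3p9 (p beta n : nat) (alpha : 'I_n -> nat) :
  prime p -> (1 <= beta)%N -> (0 < n)%N -> (forall j, 1 <= alpha j)%N ->
  let amax := (\max_(j < n) alpha j)%N in
  let D := ((\sum_(j < n) p ^ alpha j) - n + (beta - 1) * (p - 1) * p ^ (amax - 1))%N in
  let L := fun x : 'I_n -> int =>
             \prod_(j < n) lagrange_fn ((p ^ alpha j)%N) ((p ^ beta)%N) (x j) in
  (forall P : polyfract n ((p ^ beta)%N),
      periodic_in (fun j => p ^ alpha j)%N (pf_eval P) -> (pf_deg P <= D)%N)
  /\ (exists Q : polyfract n ((p ^ beta)%N), forall x, pf_eval Q x = L x)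
  /\ (forall Q : polyfract n ((p ^ beta)%N),
        (forall x, pf_eval Q x = L x) -> pf_deg Q = D).
Proof.
move=> p_pr beta_gt0 n_gt0 alpha_gt0 amax D L.
(* Each [p ^ alpha j] is positive, so the subtraction of [n] is not truncated and can be spread over
   the summands. *)
have DE : D = (\sum_(j < n) (p ^ alpha j).-1
               + beta.-1 * ((p - 1) * p ^ (\max_(j < n) alpha j).-1))%N.
  rewrite /D !subn1 -mulnA; congr (_ + _)%N.
  have q_gt0 j : (0 < p ^ alpha j)%N by rewrite expn_gt0 prime_gt0.
  under eq_bigr => j _ do rewrite -(prednK (q_gt0 j)) -addn1.
  by rewrite big_split /= sum1_card card_ord addnK.
rewrite DE; split; first exact: pf_deg_periodic_le.
split; first exact: lagrange_polyfract_ex.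
move=> Q QL; apply/eqP; rewrite eqn_leq; apply/andP; split.
  apply: pf_deg_periodic_le => // j x; rewrite !QL.
  exact: periodic_lagrange_prod.
exact: pf_deg_lagrange_ge.
Qed.
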